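(* Let $k$ be a positive integer and let $f \in \widetilde{\mathcal{P}}_k$. Then there is a constant $C_f>0$, depending only on $f$, such that for every positive integer $N \in k\mathbb{Z}$, \[ \left| \log \left( \# \operatorname{RP}(\lambda(f,N)) \right) - N \log N - B_f \cdot N - \frac{1}{2} \log N - D_f \right| \le \frac{C_f}{N}, \] where $B_f = \lim_{\varepsilon\searrow 0}\int_\varepsilon^1 \log(f(x)+x-1)\,dx$ and \[ D_f := \frac{1}{2} \log(2\pi) + \frac{1}{2} \sum_{i=1}^k \int_{(i-1)/k}^{i/k} \frac{xf'(x) - f(x) + 1}{x(f(x)+x-1)}\, dx \] (each integral being over an interval on whose interior $f$ is linear).
   Context: The class $\mathcal{P}$ consists of all functions $f:[0,1]\to[0,1]$ such that: $f$ is weakly decreasing; $f$ is piecewise linear with finitely many non-differentiable points; all non-differentiable points of $f$ are rational numbers in $[0,1]$; there is $\varepsilon>0$ with $f(x)=1$ for all $0\le x<\varepsilon$; $f(1)>0$; and for every $a\in(0,1)$, $\lim_{x\searrow a} f(x) > 1-a$. For a positive integer $k$, $\widetilde{\mathcal{P}}_k$ is the set of $f\in\mathcal{P}$ such that: $k f(i/k)\in\mathbb{Z}$ for each $i\in\{1,\ldots,k\}$; $f$ is upper-semicontinuous; and for each $i\in\{1,\ldots,k\}$ the restriction of $f$ to $((i-1)/k,i/k)$ is linear with a non-positive integer slope. For a positive integer $N$, $\lambda(f,N)$ is the partition with exactly $N$ parts whose $i$-th part is $\lceil N f(i/N)\rceil$. For a partition $\lambda=(\lambda_1\ge\cdots\ge\lambda_n)$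 with exactly $n$ parts, $\operatorname{RP}(\lambda)$ is the set of $n\times n$ permutation matrices $\pi=(\pi_{ij})$ such that $\pi_{ij}=0$ whenever $j>\lambda_{n+1-i}$. *)

(* Defs.v *)
From HB Require Import structures.
From mathcomp Require Import all_boot all_order all_algebra.
From mathcomp Require Import all_classical all_reals all_analysis.

Set Implicit Arguments.
Unset Strict Implicit.
Unset Printing Implicit Defensive.

Import Order.TTheory GRing.Theory Num.Theory.
Import numFieldNormedType.Exports.

Local Open Scope ring_scope.

(* Row and column [i : 'I_n] stands for the 1-based index [i.+1], and
   [tnth lam i] is the part number [i.+1], so that the part number [n + 1 - i.+1]
   is [tnth lam (rev_ord i)].  The 0-1 matrices have entries in [bool], whose ring
   structure has [0 = false] and [1 = true]. *)
Definition RP n (lam : n.-tuple nat) : {set 'M[bool]_n} :=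
  [set A : 'M[bool]_n | is_perm_mx A &
    [forall i : 'I_n, forall j : 'I_n,
      (tnth lam (rev_ord i) < j.+1)%N ==> (A i j == 0)]].

(* For [f] in [classP] below the ceilings are positive, so [`| _ |%N] is only a
   cast from [int] to [nat]. *)
Definition lambda (R : realType) (f : R -> R) (N : nat) : N.-tuple nat :=
  [tuple `|Num.ceil (N%:R * f (i.+1%:R / N%:R))|%N | i < N].

Local Open Scope classical_set_scope.

(* A function on [0, 1] is encoded as [f : R -> R]; no definition below looks at
   the values of [f] outside of [0, 1]. *)

Definition affine_on (R : realType) (f : R -> R) (a b : R) :=
  exists m c : R, forall x : R, a < x < b -> f x = m * x + c.

Definition piecewise_linear (R : realType) (f : R -> R) :=
  exists s : seq R, itv_partition 0 1 s /\
    forall i, (i < size s)%N -> affine_on f (nth 0 (0 :: s) i) (nth 0 s i).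

(* Differentiability is relative to [0, 1], hence one-sided at 0 and at 1. *)
Definition nondiff (R : realType) (f : R -> R) : set R :=
  [set x : R | 0 <= x <= 1 /\
    ~ cvg ((f y - f x) / (y - x) @[y --> within `[0, 1] x^'])].

Definition usc (R : realType) (f : R -> R) :=
  forall x : R, 0 <= x <= 1 -> forall a : R, f x < a ->
    \forall y \near within `[0, 1] (nbhs x), f y < a.

Record classP (R : realType) (f : R -> R) : Prop := ClassP {
  classP_range : forall x : R, 0 <= x <= 1 -> 0 <= f x <= 1;
  classP_decr : forall x y : R, 0 <= x -> x <= y -> y <= 1 -> f y <= f x;
  classP_pl : piecewise_linear f;
  classP_finite : finite_set (nondiff f);
  classP_rat : forall x : R, nondiff f x -> exists q : rat, x = ratr q;
  classP_near0 :
    exists e : R, 0 < e /\ forall x : R, 0 <= x <= 1 -> x < e -> f x = 1;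
  classP_at1 : 0 < f 1;
  classP_rlim : forall a : R, 0 < a < 1 -> 1 - a < lim (f x @[x --> a^'+])
}.

Record classPtilde (R : realType) (k : nat) (f : R -> R) : Prop := ClassPtilde {
  classPtilde_P : classP f;
  classPtilde_val : forall i, (1 <= i <= k)%N ->
    k%:R * f (i%:R / k%:R) \is a Num.int;
  classPtilde_usc : usc f;
  classPtilde_lin : forall i, (1 <= i <= k)%N ->
    exists (m : int) (c : R), m <= 0 /\
      forall x : R, i.-1%:R / k%:R < x < i%:R / k%:R -> f x = m%:~R * x + c
}.

Definition B_ (R : realType) (f : R -> R) : R :=
  lim (\int[lebesgue_measure]_(x in `[e, 1]) ln (f x + x - 1) @[e --> 0^'+]).

(* The open intervals of integration avoid the junk values that [derive1 f] takes at
   the breakpoints. *)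
Definition D_ (R : realType) (k : nat) (f : R -> R) : R :=
  2^-1 * ln (2 * pi) +
  2^-1 * \sum_(1 <= i < k.+1)
    \int[lebesgue_measure]_(x in `]i.-1%:R / k%:R, i%:R / k%:R[)
      ((x * derive1 f x - f x + 1) / (x * (f x + x - 1))).

(* Main.v *)
Require Import Defs.
From mathcomp Require Import all_boot all_order all_algebra.
From mathcomp Require Import all_classical all_reals all_analysis.
From mathcomp Require Import measurable_realfun perm ring lra zify.

(* Counting rook placements row by row, from the shortest row, gives
   #RP(lambda(f, N)) = prod_j (lambda_j + j - N).  When k divides N, left
   continuity (from upper semicontinuity and monotonicity) and the integral slopes
   make N f(j/N) an integer, so the product is prod_j N g(j/N) with
   g x = f x + x - 1.  Writing ln g = ln x + ln (g x / x), the first part sums to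
   ln N! - N ln N, which Stirling's formula evaluates, while the second vanishes
   near 0 and is smooth on each of the k pieces, where the trapezoid rule with
   step 1/N yields N times the integral, plus half of the increments, up to
   O(1/N).  Since (x f' - f + 1) / (x g) is the derivative of ln (g x / x), the
   increments make up D_f.  The constant does not depend on k, because the bounds
   on the second derivative of ln (g x / x) can be read off from any fixed
   subdivision that is admissible for f. *)

Set Implicit Arguments.
Unset Strict Implicit.
Unset Printing Implicit Defensive.

Import Order.TTheory GRing.Theory Num.Theory.
Import numFieldNormedType.Exports.

Local Open Scope ring_scope.

(** * Rook placements on a Ferrers board *)

Section RookCount.
Local Open Scope nat_scope.

(* A partial rook placement listed from its last row to its first: the letter
   in front of a word of length [r] is the column of the rook in row [r]. *)
Fixpoint rook_word (n : nat) (a : nat -> nat) (s : seq 'I_n) : bool :=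
  if s is x :: s' then [&& x < a (size s'), x \notin s' & rook_word a s']
  else true.

Lemma rook_word_uniq n a (s : seq 'I_n) : rook_word a s -> uniq s.
Proof. by elim: s => //= x s IH /and3P[_ -> /IH]. Qed.

(** The row bounds grow, so the columns taken in earlier rows all lie below the bound of the next
    row and reduce its choices one for one. *)
Lemma rook_word_lt n (a : nat -> nat) m (s : seq 'I_n) :
  {in gtn m &, {homo a : i j / i <= j}} -> size s < m -> rook_word a s ->
  forall x, x \in s -> x < a (size s).
Proof.
move=> ha; elim: s => //= x s IH sm /and3P[xa _ ws] y.
have sle : a (size s) <= a (size s).+1.
  by apply: ha; rewrite ?inE //; exact: ltnW.
rewrite in_cons => /predU1P[->|ys]; first exact: leq_trans xa sle.
by apply: leq_trans sle; apply: IH => //; exact: ltnW.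
Qed.

(** Induction on the rows: the new letter must avoid the [m] distinct columns already taken, all of
    them below [a m], so it has [a m - m] choices whatever the shorter word is. *)
Lemma card_rook_word n (a : nat -> nat) m :
  {in gtn m &, {homo a : i j / i <= j}} -> (forall i, i < m -> a i <= n) ->
  #|[set t : m.-tuple 'I_n | rook_word a t]| = \prod_(i < m) (a i - i).
Proof.
elim: m => [|m IH] ha an.
  by rewrite big_ord0 (@fintype.eq_card1 _ [tuple]) // => t; rewrite [t]tuple0 inE.
rewrite big_ord_recr /= -IH; last 2 first.
- by move=> i j im jm; apply: ha; rewrite !inE in im jm *; exact: ltnW.
- by move=> i im; apply: an; exact: ltnW.
rewrite -!sum1dep_card.
rewrite (reindex (fun p : m.-tuple 'I_n * 'I_n => [tuple of p.2 :: p.1])) /=;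
  last first.
  exists (fun t : m.+1.-tuple 'I_n => ([tuple of behead t], thead t)).
    by move=> [t x] _ /=; congr pair; apply: val_inj.
  by move=> t _; rewrite [RHS]tuple_eta.
rewrite (eq_bigl (fun p : m.-tuple 'I_n * 'I_n =>
    rook_word a p.1 && ((p.2 < a m) && (p.2 \notin val p.1)))); last first.
  by move=> [t x] /=; rewrite size_tuple andbA andbC.
rewrite -(pair_big_dep (fun t : m.-tuple 'I_n => rook_word a t)
   (fun t (x : 'I_n) => (x < a m) && (x \notin val t)) (fun _ _ => 1)) /=.
rewrite big_distrl /=; apply: eq_bigr => t wt; rewrite mul1n.
rewrite sum1dep_card.
have lt_am x : x \in val t -> x < a m.
  move=> xt; rewrite -(size_tuple t).
  by apply: (rook_word_lt ha) => //; rewrite size_tuple.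
have -> : [set x : 'I_n | (x < a m) && (x \notin val t)] =
   [set x : 'I_n | x < a m] :\: [set x in val t].
  by apply/setP => x; rewrite !inE andbC.
rewrite cardsD.
have -> : [set x : 'I_n | x < a m] :&: [set x in val t] = [set x in val t].
  apply/setP => x; rewrite !inE.
  by have [/lt_am ->|] := boolP (x \in val t); rewrite ?andbF.
rewrite (_ : #|[set x in val t]| = m); last first.
  rewrite -[RHS](size_tuple t) -(card_uniqP (rook_word_uniq wt)).
  by apply: eq_card => x; rewrite inE.
congr subn.
rewrite -sum1dep_card -(big_ord_widen n (fun _ => 1) (an m (ltnSn m))).
by rewrite sum1_card card_ord.
Qed.

Lemma rook_wordP n (a : nat -> nat) (s : seq 'I_n) :
  reflect (uniq s /\ forall x0 i, i < size s -> nth x0 s i < a (size s - i.+1))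
    (rook_word a s).
Proof.
elim: s => [|x s IH] /=; first by apply: ReflectT; split.
apply: (iffP and3P) => [[xa xs /IH[us ws]]|[/andP[xs us] ws]].
  split; first by rewrite xs.
  move=> x0 [|i] /= im; first by rewrite subn1.
  by rewrite subSS; exact: ws.
split=> //; first by have := ws x 0 isT; rewrite subn1.
by apply/IH; split => // x0 i im; have := ws x0 i.+1 im; rewrite subSS.
Qed.

(** The matrices in [RP lam] are in bijection with the rook words of length [n] whose row bounds [a]
    are the parts in reverse order, hence nondecreasing. *)
Lemma card_RP n (lam : n.-tuple nat) :
  (forall i j : 'I_n, i <= j -> tnth lam j <= tnth lam i) ->
  (forall i, tnth lam i <= n) ->
  #|RP lam| = \prod_(i < n) (tnth lam i - (n - i.+1)).
Proof.
move=> lamd lamn.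
pose a i := nth 0 lam (n - i.+1).
have aE i : i < n -> exists2 j : 'I_n, j = n - i.+1 :> nat & a i = tnth lam j.
  move=> ni; have ji : n - i.+1 < n by lia.
  by exists (Ordinal ji); rewrite ?(tnth_nth 0).
have ahomo : {in gtn n &, {homo a : i j / i <= j}}.
  move=> i j; rewrite !inE => im jm ij.
  have [i' Ei ->] := aE i im; have [j' Ej ->] := aE j jm.
  by apply: lamd; lia.
have an i : i < n -> a i <= n by move=> /aE[j _ ->].
rewrite (reindex_inj rev_ord_inj) /=.
rewrite (eq_bigr (fun i : 'I_n => a i - i)); last first.
  move=> i _; rewrite (tnth_nth 0) /a /=; congr subn.
  by have := ltn_ord i; lia.
rewrite -(@card_rook_word n a n) //.
(* The columns of [s] are listed from the last row to the first, as [rook_word] reads them. *)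
pose w (s : {perm 'I_n}) := [tuple s (rev_ord i) | i < n].
have w_inj : injective w.
  move=> s s' ww; apply/permP => i; rewrite -(rev_ordK i).
  by have := congr1 (fun t => tnth t (rev_ord i)) ww; rewrite !tnth_mktuple.
have pmx_inj : injective (@perm_mx bool n).
  move=> s s' /matrixP ss'; apply/permP => i.
  by have := ss' i (s i); rewrite !mxE eqxx; case: (s' i =P s i).
rewrite (_ : RP lam = [set perm_mx s | s : {perm 'I_n} & rook_word a (w s)]).
  rewrite (card_imset _ pmx_inj).
  rewrite -(card_imset _ w_inj); apply: eq_card => t.
  apply/imsetP/idP => [[s ws] ->|]; rewrite inE; first by rewrite inE in ws.
  move=> wt.
  have ut := rook_word_uniq wt.
  have tinj : injective (fun i => tnth t (rev_ord i)).
    move=> i j /(tuple_uniqP _ ut) /rev_ord_inj //.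
  have E : w (perm tinj) = t.
    by apply: eq_from_tnth => i; rewrite tnth_mktuple permE rev_ordK.
  by exists (perm tinj); rewrite ?inE E.
apply/setP => A; apply/idP/imsetP.
  rewrite inE => /andP[/is_perm_mxP[s ->] /forallP h].
  exists s => //; rewrite inE; apply/rook_wordP; split.
    by apply/tuple_uniqP => i j; rewrite !tnth_mktuple => /perm_inj/rev_ord_inj.
  rewrite size_tuple => x0 i im.
  rewrite -[i]/(nat_of_ord (Ordinal im)) -tnth_nth tnth_mktuple /a.
  have := forallP (h (rev_ord (Ordinal im))) (s (rev_ord (Ordinal im))).
  by rewrite !mxE eqxx /= implybF -leqNgt (tnth_nth 0).
case=> s; rewrite inE => /rook_wordP[_]; rewrite size_tuple => ws ->.
rewrite inE perm_mx_is_perm /=; apply/forallP => i; apply/forallP => j.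
apply/implyP => lj; rewrite !mxE; case: (s i =P j) => // sij.
have im : n - i.+1 < n by have := ltn_ord i; lia.
have := ws i _ im.
rewrite -[X in nth _ _ X]/(nat_of_ord (rev_ord i)) -tnth_nth tnth_mktuple.
rewrite rev_ordK sij /a; move: lj; rewrite (tnth_nth 0) /= ltnNge.
have -> : n - (n - (n - i.+1).+1).+1 = n - i.+1 by have := ltn_ord i; lia.
by move/negbTE ->.
Qed.

End RookCount.

Local Open Scope classical_set_scope.

(** * Logarithms of affine functions, their primitives, and the trapezoid rule *)

Section Calculus.
Context {R : realType}.
Implicit Types (f F df : R -> R) (a b x : R).
Local Notation mu := (@lebesgue_measure R).

Lemma is_derive1_continuous f x (d : R) :
  is_derive x 1 f d -> {for x, continuous f}.
Proof. by move=> [/derivable1_diffP/differentiable_continuous]. Qed.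

Lemma continuous_segment f a b :
  (forall x, a <= x <= b -> {for x, continuous f}) ->
  {within `[a, b], continuous f}.
Proof.
move=> cf; apply: continuous_in_subspaceT => x; rewrite inE /= in_itv /=.
exact: cf.
Qed.

Lemma integrable_segment f a b :
  (forall x, a <= x <= b -> {for x, continuous f}) ->
  mu.-integrable `[a, b] (EFin \o f).
Proof.
move=> cf; apply: continuous_compact_integrable; first exact: segment_compact.
exact: continuous_segment.
Qed.

Lemma MVT_closed f df a b : a <= b ->
  (forall x, a <= x <= b -> is_derive x 1 f (df x)) ->
  exists2 c, a <= c <= b & f b - f a = df c * (b - a).
Proof.
move=> ab d; have [||c] := @MVT_segment R f df a b ab.
- move=> x; rewrite in_itv /= => /andP[ax xb]; apply: d.
  by rewrite (ltW ax) (ltW xb).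
- by apply: continuous_segment => x /d /is_derive1_continuous.
by rewrite in_itv /=; exists c.
Qed.

Lemma derive_ge0_le f df a b : a <= b ->
  (forall x, a <= x <= b -> is_derive x 1 f (df x)) ->
  (forall x, a <= x <= b -> 0 <= df x) -> f a <= f b.
Proof.
move=> ab d df0; have [c cab E] := MVT_closed ab d.
by rewrite -subr_ge0 E mulr_ge0 ?df0 ?subr_ge0.
Qed.

Lemma Rintegral_FTC f F a b : a < b ->
  (forall x, a <= x <= b -> is_derive x 1 F (f x)) ->
  (forall x, a <= x <= b -> {for x, continuous f}) ->
  \int[mu]_(x in `[a, b]) f x = F b - F a.
Proof.
move=> ab dF cf; rewrite /Rintegral (@continuous_FTC2 _ f F) //.
- exact: continuous_segment.
- have cF x : a <= x <= b -> {for x, continuous F}.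
    by move=> /dF /is_derive1_continuous.
  split.
  + move=> x; rewrite in_itv /= => /andP[ax xb].
    by have [] : is_derive x 1 F (f x) by apply: dF; rewrite !ltW.
  + by apply: cvg_at_right_filter; apply: cF; rewrite lexx ltW.
  + by apply: cvg_at_left_filter; apply: cF; rewrite lexx ltW.
- move=> x; rewrite in_itv /= => /andP[ax xb].
  rewrite derive1E.
  by have [_ ->] : is_derive x 1 F (f x) by apply: dF; rewrite !ltW.
Qed.

Lemma is_derive_ln_affine (al be x : R) : 0 < al * x + be ->
  is_derive x 1 (fun y => ln (al * y + be)) (al / (al * x + be)).
Proof.
move=> h0.
have h1 : is_derive x 1 (fun y => al * y + be) al.
  by apply: is_derive_eq; rewrite /GRing.scale /=; ring.
rewrite mulrC.
exact: (is_derive1_comp (g := fun y => al * y + be) (is_derive1_ln h0) h1).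
Qed.

Lemma continuous_ln_affine (al be x : R) : 0 < al * x + be ->
  {for x, continuous (fun y => ln (al * y + be))}.
Proof. by move=> /is_derive_ln_affine /is_derive1_continuous. Qed.

Lemma is_derive_inv_affine (al be x : R) : 0 < al * x + be ->
  is_derive x 1 (fun y => al / (al * y + be)) (- (al / (al * x + be)) ^+ 2).
Proof.
move=> h0.
have h1 : is_derive x 1 (fun y => al * y + be) al.
  by apply: is_derive_eq; rewrite /GRing.scale /=; ring.
have h2 := is_deriveV (f := fun y => al * y + be) (lt0r_neq0 h0) h1.
have -> : (fun y => al / (al * y + be)) = al *: (fun y => (al * y + be)^-1).
  by apply/funext.
apply: is_derive_eq; rewrite /GRing.scale /=.
by field; rewrite lt0r_neq0.
Qed.

(* [y ln y - y] rescaled, except that a constant integrand has to be treated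
   separately. *)
Lemma exists_primitive_ln_affine (al be : R) : exists H : R -> R,
  forall x, 0 < al * x + be -> is_derive x 1 H (ln (al * x + be)).
Proof.
have [->|al0] := eqVneq al 0.
  exists (fun x => ln be * x) => x; rewrite mul0r add0r => _.
  by apply: is_derive_eq; rewrite /GRing.scale /=; ring.
exists (fun x => al^-1 * ((al * x + be) * ln (al * x + be) - (al * x + be))).
move=> x h0; have h1 := is_derive_ln_affine h0.
apply: is_derive_eq; rewrite /GRing.scale /=.
by field; rewrite al0 lt0r_neq0.
Qed.

(** Three mean values: for the error [phi] as a function of the right end, then for [h], then for
    [h1]. The error becomes [- h2 eta * (c - xi) * (c - a) * (b - a) / 2], which is estimated
    generously: the optimal constant is [K / 12]. *)
Lemma trapezoid_error (H h h1 h2 : R -> R) (a b K : R) : a <= b ->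
  (forall x, a <= x <= b -> is_derive x 1 H (h x)) ->
  (forall x, a <= x <= b -> is_derive x 1 h (h1 x)) ->
  (forall x, a <= x <= b -> is_derive x 1 h1 (h2 x)) ->
  (forall x, a <= x <= b -> `|h2 x| <= K) ->
  `|H b - H a - (b - a) * ((h a + h b) / 2)| <= K * (b - a) ^+ 3.
Proof.
move=> ab dH dh dh1 hK.
pose phi x := H x - H a - (x - a) * ((h a + h x) / 2).
have dphi x : a <= x <= b ->
    is_derive x 1 phi ((h x - h a - (x - a) * h1 x) / 2).
  move=> xab; have := dH x xab; have := dh x xab => dhx dHx.
  rewrite /phi; apply: is_derive_eq; rewrite /GRing.scale /=.
  by field.
have [c /andP[ac cb]] := MVT_closed ab dphi.
have phia : phi a = 0 by rewrite /phi; ring.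
rewrite phia subr0 -/(phi b) => ->.
have [|xi /andP[axi xic] ->] := @MVT_closed h h1 a c ac.
  by move=> x /andP[ax xc]; apply: dh; rewrite ax (le_trans xc).
have [|eta /andP[xeta etac] E] := @MVT_closed h1 h2 xi c xic.
  by move=> x /andP[ax xc]; apply: dh1; rewrite (le_trans axi ax) (le_trans xc).
have -> : (h1 xi * (c - a) - (c - a) * h1 c) / 2 * (b - a)
    = - ((h1 c - h1 xi) * (c - a) * (b - a) / 2) by field.
have K2 : `|h2 eta| <= K.
  by apply: hK; rewrite (le_trans axi xeta) (le_trans etac cb).
have K0 : 0 <= K by apply: le_trans K2.
rewrite E normrN !normrM (ger0_norm (_ : 0 <= c - xi)) ?subr_ge0 //.
rewrite (ger0_norm (_ : 0 <= c - a)) ?subr_ge0 //.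
rewrite (ger0_norm (_ : 0 <= b - a)) ?subr_ge0 //.
rewrite (ger0_norm (_ : 0 <= 2^-1)) ?invr_ge0 //.
apply: (@le_trans _ _ (K * (b - a) * (b - a) * (b - a) / 2)).
  rewrite ler_wpM2r ?invr_ge0 // ler_wpM2r ?subr_ge0 //.
  by apply: ler_pM; rewrite ?mulr_ge0 ?ler_pM //; lra.
have : 0 <= K * (b - a) ^+ 3 by rewrite mulr_ge0 // exprn_ge0 // subr_ge0.
nra.
Qed.

End Calculus.

(** * Wallis integrals *)

Section Wallis.
Context {R : realType}.
Local Notation mu := (@lebesgue_measure R).

Definition wallis (n : nat) : R :=
  \int[mu]_(x in `[0, pi / 2]) (sin x ^+ n).

Lemma is_derive_sinX n (x : R) :
  is_derive x 1 (fun y : R => sin y ^+ n) (n%:R * sin x ^+ n.-1 * cos x).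
Proof. by rewrite -exprfctE; exact: is_deriveX. Qed.

Lemma continuous_sinX n (x : R) : {for x, continuous (fun y : R => sin y ^+ n)}.
Proof. exact: is_derive1_continuous (is_derive_sinX n x). Qed.

Lemma integrable_sinX n : mu.-integrable `[0, pi / 2] (fun x => (sin x ^+ n)%:E).
Proof. by apply: integrable_segment => x _; exact: continuous_sinX. Qed.

Lemma wallis0 : wallis 0 = pi / 2.
Proof.
have pi0 : 0 < pi / 2 :> R by rewrite divr_gt0 ?pi_gt0.
rewrite /wallis (Rintegral_FTC (F := id) pi0) ?subr0 // => x _.
exact: continuous_sinX.
Qed.

Lemma wallis1 : wallis 1 = 1.
Proof.
have pi0 : 0 < pi / 2 :> R by rewrite divr_gt0 ?pi_gt0.
have d (x : R) : 0 <= x <= pi / 2 -> is_derive x 1 (fun x => - cos x) (sin x ^+ 1).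
  by move=> _; apply: is_derive_eq; rewrite opprK.
rewrite /wallis (Rintegral_FTC pi0 d); last by move=> x _; exact: continuous_sinX.
by rewrite cos_pihalf cos0 oppr0 opprK add0r.
Qed.

(** Integration by parts: [cos x * sin x ^+ n.+1] vanishes at both ends, so its derivative
    integrates to 0. *)
Lemma wallisSS n : n.+2%:R * wallis n.+2 = n.+1%:R * wallis n.
Proof.
have pi0 : 0 < pi / 2 :> R by rewrite divr_gt0 ?pi_gt0.
have d (x : R) : 0 <= x <= pi / 2 -> is_derive x 1
    (fun x => cos x * sin x ^+ n.+1)
    (n.+1%:R * sin x ^+ n - n.+2%:R * sin x ^+ n.+2).
  move=> _; have d := is_derive_sinX n.+1 x.
  apply: is_derive_eq; rewrite /GRing.scale /= !exprS.
  have := cos2Dsin2 x; rewrite !expr2 => c2.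
  have -> : cos x * (n.+1%:R * sin x ^+ n * cos x) =
    n.+1%:R * sin x ^+ n * (1 - sin x * sin x) by rewrite -c2; ring.
  by rewrite -[n.+2%:R]natr1; ring.
have cs (c : R) m (x : R) : {for x, continuous (fun y : R => c * sin y ^+ m)}.
  by apply: (@continuousM _ R); [exact: cst_continuous|exact: continuous_sinX].
have I0 : \int[mu]_(x in `[0, pi / 2])
    (n.+1%:R * sin x ^+ n - n.+2%:R * sin x ^+ n.+2) = 0.
  rewrite (Rintegral_FTC pi0 d).
    by rewrite cos_pihalf sin0 expr0n /= mul0r mulr0 subrr.
  by move=> x _; apply: (@continuousB _ R^o R); exact: cs.
apply/esym/eqP; rewrite -subr_eq0 -I0 RintegralB //.
- by rewrite !RintegralZl //; exact: integrable_sinX.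
- by apply: integrable_segment => x _; exact: cs.
- by apply: integrable_segment => x _; exact: cs.
Qed.

Lemma sin_pihalf_itv (x : R) : 0 <= x <= pi / 2 -> 0 <= sin x <= 1.
Proof.
move=> /andP[x0 xpi]; rewrite sin_le1 andbT.
apply: sin_ge0_pi; rewrite x0 (le_trans xpi) //.
by have := pi_gt0 R; lra.
Qed.

Lemma wallis_ge0 n : 0 <= wallis n.
Proof.
apply: Rintegral_ge0 => x; rewrite /= in_itv /= => /sin_pihalf_itv/andP[s0 _].
exact: exprn_ge0.
Qed.

Lemma wallis_le n : wallis n.+1 <= wallis n.
Proof.
apply: le_Rintegral => //; try exact: integrable_sinX.
move=> x; rewrite /= in_itv /= => /sin_pihalf_itv/andP[s0 s1].
by rewrite exprS ler_piMl ?exprn_ge0.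
Qed.

(** By the recurrence, [n.+1%:R * wallis n * wallis n.+1] does not depend on [n]; at 0 it is
    [pi / 2]. *)
Lemma wallis_mul n : wallis n * wallis n.+1 = pi / (2 * n.+1%:R).
Proof.
elim: n => [|n IH]; first by rewrite wallis0 wallis1 !mulr1.
have E : wallis n.+2 = n.+1%:R / n.+2%:R * wallis n.
  by rewrite mulrAC -wallisSS mulrAC divff ?mul1r // pnatr_eq0.
rewrite E mulrCA [wallis _ * _]mulrC IH.
have : n.+1%:R != 0 :> R by rewrite pnatr_eq0.
have : n.+2%:R != 0 :> R by rewrite pnatr_eq0.
by move: (n.+1%:R) (n.+2%:R) => p q q0 p0; field; rewrite p0 q0.
Qed.

Lemma wallis_gt0 n : 0 < wallis n.
Proof.
rewrite lt_neqAle wallis_ge0 andbT eq_sym; apply/negP => /eqP W0.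
have /eqP := wallis_mul n; rewrite W0 mul0r eq_sym.
by rewrite gt_eqF // divr_gt0 ?pi_gt0 // mulr_gt0 ?ltr0n.
Qed.

(** The classical closed form of the even Wallis integrals, with denominators cleared so that its
    logarithm splits easily. *)
Lemma wallis_even n :
  wallis n.*2 * n`!%:R ^+ 2 * 4 ^+ n = n.*2`!%:R * (pi / 2).
Proof.
elim: n => [|n IH]; first by rewrite wallis0 /= expr1n !mulr1 mul1r.
have E : wallis n.*2.+2 = n.*2.+1%:R / n.*2.+2%:R * wallis n.*2.
  by rewrite mulrAC -wallisSS mulrAC divff ?mul1r // pnatr_eq0.
rewrite doubleS E !factS !natrM [4 ^+ n.+1]exprS.
have -> : n.*2.+2%:R = 2 * n.+1%:R :> R by rewrite -doubleS -mul2n natrM.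
transitivity (2 * n.+1%:R * (n.*2.+1%:R * (wallis n.*2 * n`!%:R ^+ 2 * 4 ^+ n))).
  have : n.+1%:R != 0 :> R by rewrite pnatr_eq0.
  by move: (n.+1%:R) => p p0; field.
by rewrite IH !mulrA.
Qed.

End Wallis.

(** * Stirling's formula with an explicit error of order [1 / n] *)

Section Stirling.
Context {R : realType}.

(** The logarithm of [n! * e^n / n^(n + 1/2)], whose limit is [ln (2 * pi) / 2]. *)
Definition stirling_defect (n : nat) : R :=
  ln n`!%:R - (n%:R + 2^-1) * ln n%:R + n%:R.

(** Everything vanishes at 0, so derivatives are compared: the difference between [ln (1 + x)] and
    its Padé approximant has derivative [x ^+ 2 / ((1 + x) * (2 + x) ^+ 2)], which lies between 0
    and [x ^+ 2 / 4]. *)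
Lemma ln1D_Pade (t : R) : 0 <= t ->
  0 <= ln (1 + t) - 2 * t / (2 + t) <= t ^+ 3 / 12.
Proof.
move=> t0.
have d x : 0 <= x <= t -> is_derive x 1 (fun y : R => ln (1 + y) - 2 * y / (2 + y))
    (x ^+ 2 / ((1 + x) * (2 + x) ^+ 2)).
  move=> /andP[x0 _].
  have h1 : 0 < 1 * x + 1 by lra.
  have dl : is_derive x 1 (fun y : R => ln (1 + y)) (1 + x)^-1.
    have := is_derive_ln_affine h1; rewrite div1r mul1r (addrC x).
    by under [X in is_derive _ _ X]eq_fun do rewrite mul1r addrC.
  have n2 : 2 + x != 0 by rewrite lt0r_neq0 //; lra.
  have d2 : is_derive x 1 (fun y : R => 2 + y) 1.
    by apply: is_derive_eq; ring.
  have dv := is_deriveV (f := fun y => 2 + y) n2 d2.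
  apply: is_derive_eq; rewrite /GRing.scale /=.
  by field; rewrite n2 lt0r_neq0 //; lra.
have P x : 0 <= x <= t -> 0 < (1 + x) * (2 + x) ^+ 2.
  by move=> /andP[x0 _]; rewrite mulr_gt0 ?exprn_gt0; lra.
apply/andP; split.
  have := derive_ge0_le t0 d; rewrite addr0 ln1 mulr0 mul0r subr0; apply.
  by move=> x xt; rewrite divr_ge0 ?sqr_ge0 // ltW // P.
have := @derive_ge0_le _ (fun y => y ^+ 3 / 12 - (ln (1 + y) - 2 * y / (2 + y)))
  (fun x => x ^+ 2 / 4 - x ^+ 2 / ((1 + x) * (2 + x) ^+ 2)) 0 t t0.
rewrite addr0 ln1 mulr0 mul0r subr0 expr0n /= mul0r subr0 subr_ge0; apply.
  move=> x xt; have dx := d x xt; apply: is_derive_eq.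
  rewrite /GRing.scale /=; field.
  by move: xt => /andP[x0 _]; rewrite !lt0r_neq0 //; lra.
move=> x xt; rewrite subr_ge0 ler_wpM2l ?sqr_ge0 // lef_pV2 ?posrE ?P //.
by move: xt => /andP[x0 _]; nra.
Qed.

(** With [t = 1 / n] the difference is [(2 + t) / (2 * t)] times the Padé error, at most
    [t ^+ 2 * (2 + t) / 24]. Since [t <= 1], this is below [t ^+ 2 / (4 * (1 + t))], which
    telescopes in [n]. *)
Lemma stirling_defect_step n : (0 < n)%N ->
  0 <= stirling_defect n - stirling_defect n.+1 <=
    4^-1 * (n%:R^-1 - n.+1%:R^-1).
Proof.
move=> n0; have N0 : 0 < n%:R :> R by rewrite ltr0n.
have N1 : 1 <= n%:R :> R by rewrite ler1n.
have -> : stirling_defect n - stirling_defect n.+1 =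
    (n%:R + 2^-1) * ln (1 + n%:R^-1) - 1.
  have -> : 1 + n%:R^-1 = n.+1%:R / n%:R :> R.
    by rewrite -natr1; field; rewrite lt0r_neq0.
  rewrite ln_div ?posrE ?ltr0n // /stirling_defect factS natrM lnM ?posrE ?ltr0n ?fact_gt0 //.
  by rewrite -natr1; field.
set t := n%:R^-1; have t0 : 0 < t by rewrite invr_gt0.
have t1 : t <= 1 by rewrite invf_le1.
have -> : n%:R + 2^-1 = (2 + t) / (2 * t).
  by rewrite /t; field; rewrite lt0r_neq0.
have -> : t - n.+1%:R^-1 = t ^+ 2 / (1 + t).
  rewrite /t -natr1; field; rewrite !lt0r_neq0 //; lra.
have /andP[l u] := ln1D_Pade (ltW t0).
have -> : (2 + t) / (2 * t) * ln (1 + t) - 1 =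
   (2 + t) / (2 * t) * (ln (1 + t) - 2 * t / (2 + t)).
  by field; rewrite !lt0r_neq0 //; lra.
have c0 : 0 <= (2 + t) / (2 * t) by rewrite divr_ge0 //; lra.
rewrite mulr_ge0 //=; apply: le_trans (ler_wpM2l c0 u) _.
have -> : (2 + t) / (2 * t) * (t ^+ 3 / 12) = t ^+ 2 * ((2 + t) / 24).
  by field; rewrite lt0r_neq0.
rewrite [leRHS]mulrCA ler_wpM2l ?sqr_ge0 // ler_pdivlMr; last by lra.
by nra.
Qed.

Lemma stirling_defect_double n : (0 < n)%N ->
  0 <= stirling_defect n - stirling_defect n.*2 <= 4^-1 * n%:R^-1.
Proof.
move=> n0.
have H m : 0 <= stirling_defect n - stirling_defect (n + m) <=
    4^-1 * (n%:R^-1 - (n + m)%:R^-1).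
  elim: m => [|m /andP[IH1 IH2]]; first by rewrite addn0 !subrr mulr0 lexx.
  have /andP[] := @stirling_defect_step (n + m) (ltn_addr m n0).
  rewrite addnS; move: IH1 IH2; move: ((n + m)%:R^-1) ((n + m).+1%:R^-1).
  by move=> u v *; apply/andP; split; lra.
have := H n; rewrite addnn => /andP[-> /= h]; apply: (le_trans h).
have : 0 <= n.*2%:R^-1 :> R by rewrite invr_ge0.
by move: (n.*2%:R^-1) => v v0; lra.
Qed.

(** By [wallis_even] the quantity is [ln (pi / (4 * n)) / 2 - ln W], where [W] is [wallis n.*2].
    Monotonicity and [wallis_mul] place [W ^+ 2] between [pi / (2 * (2 * n + 1))] and
    [pi / (4 * n)]; the logarithmic gap [ln (1 + 1 / (2 * n))] is at most [1 / (2 * n)]. *)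
Lemma stirling_wallis n : (0 < n)%N ->
  0 <= 2 * stirling_defect n - stirling_defect n.*2 - 2^-1 * ln (2 * pi)
    <= 4^-1 * n%:R^-1.
Proof.
move=> n0; have N0 : 0 < n%:R :> R by rewrite ltr0n.
have pi0 := pi_gt0 R; have W0 m := @wallis_gt0 R m.
have F0 m : 0 < m`!%:R :> R by rewrite ltr0n fact_gt0.
have e1 := congr1 (@ln R) (@wallis_even R n).
rewrite !lnM ?posrE ?mulr_gt0 ?exprn_gt0 ?invr_gt0 // in e1.
rewrite !lnXn // lnV ?posrE // -!(mulr_natl (ln _)) in e1.
have l4 : ln (4 : R) = 2 * ln 2.
  by rewrite (_ : 4 = 2 ^+ 2 :> R) ?lnXn // ?mulr_natl // -natrX.
rewrite l4 in e1.
have D : n.*2%:R = 2 * n%:R :> R by rewrite -mul2n natrM.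
rewrite /stirling_defect D (@lnM _ 2 n%:R) ?posrE // (@lnM _ 2 pi) ?posrE //.
have up : 2 * ln (wallis n.*2) <= ln pi - 2 * ln 2 - ln n%:R :> R.
  rewrite mulr_natl -lnXn // -l4 -!ln_div ?posrE ?divr_gt0 //.
  rewrite ler_ln ?posrE ?exprn_gt0 ?divr_gt0 ?mulr_gt0 ?invr_gt0 //.
  have := @wallis_mul R n.*2.-1; rewrite prednK ?double_gt0 // D => E.
  have -> : pi / 4 / n%:R = pi / (2 * (2 * n%:R)) :> R.
    by field; rewrite lt0r_neq0.
  rewrite -E expr2 ler_wpM2r ?(ltW (W0 _)) //.
  by have := @wallis_le R n.*2.-1; rewrite prednK ?double_gt0.
have lo : ln pi - 2 * ln 2 - ln n%:R - 2^-1 * n%:R^-1 <= 2 * ln (wallis n.*2) :> R.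
  have lnle : ln (1 + 2^-1 * n%:R^-1) <= 2^-1 * n%:R^-1 :> R.
    by apply: le_ln1Dx; apply: lt_trans (_ : 0 < _); rewrite ?mulr_gt0 ?invr_gt0 // ltrN10.
  apply: le_trans (_ : ln pi - 2 * ln 2 - ln n%:R - ln (1 + 2^-1 * n%:R^-1) <= _).
    by lra.
  have p1 : 0 < 1 + 2^-1 * n%:R^-1 :> R by rewrite addr_gt0 // mulr_gt0 ?invr_gt0.
  rewrite [leRHS]mulr_natl -lnXn // -l4 -!ln_div ?posrE ?divr_gt0 ?mulr_gt0 //.
  rewrite ler_ln ?posrE ?exprn_gt0 ?divr_gt0 ?mulr_gt0 //.
  have -> : pi / 4 / n%:R / (1 + 2^-1 * n%:R^-1) = pi / (2 * (n.*2.+1)%:R) :> R.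
    rewrite -[n.*2.+1%:R]natr1 D; field; rewrite !lt0r_neq0 //; lra.
  rewrite -(@wallis_mul R n.*2) expr2 ler_wpM2l ?(ltW (W0 _)) //.
  exact: wallis_le.
have i0 : 0 < n%:R^-1 :> R by rewrite invr_gt0.
by apply/andP; split; lra.
Qed.

(* No limit is needed: Wallis evaluates [2 d_n - d_2n], where [d] is the defect,
   and [d_n] differs from it by [d_2n - d_n], which is of order [1 / n]. *)
Theorem stirling n : (0 < n)%N ->
  `|ln n`!%:R - n%:R * ln n%:R + n%:R - 2^-1 * ln n%:R - 2^-1 * ln (2 * pi)|
    <= n%:R^-1 :> R.
Proof.
move=> n0; have := stirling_wallis n0; have := stirling_defect_double n0.
have -> : ln n`!%:R - n%:R * ln n%:R + n%:R - 2^-1 * ln n%:R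
  = stirling_defect n :> R by rewrite /stirling_defect; ring.
have : 0 < n%:R^-1 :> R by rewrite invr_gt0 ltr0n.
move=> n1 /andP[a b] /andP[c d]; rewrite ler_norml; apply/andP; split; lra.
Qed.

End Stirling.

(** * Affine functions determined or bounded through an open interval *)

Section AffineLimits.
Context {R : realType}.

Lemma continuous_affine (m c x : R) : {for x, continuous (fun y : R => m * y + c)}.
Proof.
have d : is_derive x 1 (fun y => m * y + c) m.
  by apply: is_derive_eq; rewrite /GRing.scale /=; ring.
exact: is_derive1_continuous d.
Qed.

Lemma affine_ge_left (m c a b d : R) : a < b ->
  (forall x, a < x < b -> d <= m * x + c) -> d <= m * a + c.
Proof.
move=> ab h; apply: (@cvgr_to_ge _ a^'+ _ _ (fun y => m * y + c)).
  exact/cvg_at_right_filter/continuous_affine.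
near=> x; apply: h; apply/andP; split; near: x.
  exact: nbhs_right_gt.
exact: nbhs_right_lt.
Unshelve. all: end_near. Qed.

Lemma affine_ge_right (m c a b d : R) : a < b ->
  (forall x, a < x < b -> d <= m * x + c) -> d <= m * b + c.
Proof.
move=> ab h; apply: (@cvgr_to_ge _ b^'- _ _ (fun y => m * y + c)).
  exact/cvg_at_left_filter/continuous_affine.
near=> x; apply: h; apply/andP; split; near: x.
  exact: nbhs_left_gt.
exact: nbhs_left_lt.
Unshelve. all: end_near. Qed.

Lemma affine_inj (m c m' c' a b : R) : a < b ->
  (forall x, a < x < b -> m * x + c = m' * x + c') -> m = m' /\ c = c'.
Proof.
move=> ab h.
have h1 := h ((2 * a + b) / 3) ltac:(lra).
have h2 := h ((a + 2 * b) / 3) ltac:(lra).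
have mm : m = m'.
  apply/eqP; rewrite -subr_eq0.
  have : (m - m') * (b - a) = 0 by lra.
  by move/eqP; rewrite mulf_eq0 (subr_eq0 b) (gt_eqF ab) orbF.
by split=> //; move: h1; rewrite mm; lra.
Qed.

Lemma affine_ge_itv (m c a b d x : R) : a <= x <= b ->
  d <= m * a + c -> d <= m * b + c -> d <= m * x + c.
Proof.
move=> /andP[ax xb] ha hb; have [m0|m0] := leP 0 m.
  by apply: le_trans ha _; rewrite lerD2r ler_wpM2l.
by apply: le_trans hb _; rewrite lerD2r ler_wnM2l // ltW.
Qed.

End AffineLimits.

(** * The affine pieces of [f]: endpoints, positivity, integrality, uniform bounds *)

Section Blocks.
Context {R : realType}.
Implicit Types (f : R -> R) (k i : nat) (m c : R).

(** Half-open, because [f] is left continuous but may jump to the right of a breakpoint; the blocks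
    then partition []0, 1]]. *)
Definition affine_block f k i m c := forall x : R,
  i%:R / k%:R < x <= i.+1%:R / k%:R -> f x = m * x + c.

Lemma block_lt k i : (0 < k)%N -> i%:R / k%:R < i.+1%:R / k%:R :> R.
Proof. by move=> k0; rewrite ltr_pM2r ?invr_gt0 ?ltr0n // ltr_nat. Qed.

Lemma block_le1 k i : (0 < k)%N -> (i <= k)%N -> i%:R / k%:R <= 1 :> R.
Proof. by move=> k0 ik; rewrite ler_pdivrMr ?ltr0n // mul1r ler_nat. Qed.

Lemma block_ge0 k i : 0 <= i%:R / k%:R :> R.
Proof. by rewrite divr_ge0. Qed.

Lemma block_index k (x : R) : (0 < k)%N -> 0 < x <= 1 ->
  exists2 i, (i < k)%N & i%:R / k%:R < x <= i.+1%:R / k%:R.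
Proof.
move=> k0 /andP[x0 x1].
have ex : exists n, x <= n%:R / k%:R.
  by exists k; rewrite divff // pnatr_eq0 -lt0n.
case: (ex_minnP ex) => -[|n] xn nmin.
  by move: xn; rewrite mul0r leNgt x0.
exists n; last by rewrite xn andbT ltNge; apply/negP => /nmin; rewrite ltnn.
by apply: nmin; rewrite divff // pnatr_eq0 -lt0n.
Qed.

Section Ptilde.
Variables (k : nat) (f : R -> R).
Hypotheses (k0 : (0 < k)%N) (fP : classPtilde k f).
Let fC : classP f := classPtilde_P fP.

(** Only the right endpoint [x] is at stake. Monotonicity and a limit from the left give
    [f x <= m x + c]. If this were strict, upper semicontinuity would force [f y < m x + c] just
    left of [x], where [f y = m y + c >= m x + c] as [m <= 0]. *)
Lemma ptilde_affine i : (i < k)%N -> exists (m : int) c, affine_block f k i m%:~R c.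
Proof.
move=> ik; have [m [c [m0 mc]]] := @classPtilde_lin _ _ _ fP i.+1 ik.
exists m, c => x /andP[ix]; rewrite le_eqVlt => /predU1P[xb|xi]; last first.
  by apply: mc; rewrite ix.
move: mc; rewrite /= -xb; set a := _ / _ in ix *; move=> mc.
have x1 : x <= 1 by rewrite xb block_le1.
have a0 : 0 <= a by rewrite /a block_ge0.
apply/eqP; rewrite eq_le; apply/andP; split.
  apply: (affine_ge_right ix) => y /andP[ay yx]; rewrite -mc ?ay //.
  by apply: (classP_decr fC); rewrite ?(ltW yx) // (le_trans a0 (ltW ay)).
rewrite leNgt; apply/negP => lt.
have x01 : 0 <= x <= 1 by rewrite x1 (le_trans a0 (ltW ix)).
have := classPtilde_usc fP x01 lt; rewrite near_withinE => U.
have L : \forall y \near x^'-, `[0, 1]%classic y -> f y < m%:~R * x + c.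
  exact: cvg_within.
near x^'- => y.
have ay : a < y by near: y; exact: nbhs_left_gt.
have yx : y < x by near: y; exact: nbhs_left_lt.
have : f y < m%:~R * x + c.
  suff : `[0, 1]%classic y -> f y < m%:~R * x + c.
    by apply; rewrite /= in_itv /= (le_trans a0 (ltW ay)) (le_trans (ltW yx)).
  by near: y.
rewrite mc ?ay // ltrD2r ltNge => /negP; apply.
by rewrite ler_wnM2l ?(ltW yx) ?lerz0.
Unshelve. all: end_near. Qed.

(** The affine formula at [i / k] is the right limit of [f], to which the strict inequality
    [classP_rlim] applies. At [i = 0] the expression would be 0. *)
Lemma ptilde_left_gt0 i m c : (0 < i < k)%N -> affine_block f k i m c ->
  0 < (m + 1) * (i%:R / k%:R) + (c - 1).
Proof.
move=> /andP[i0 ik] mc; set a := _ / _.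
have a0 : 0 < a by rewrite divr_gt0 ?ltr0n.
have a1 : a < 1 by rewrite ltr_pdivrMr ?ltr0n // mul1r ltr_nat.
have := @classP_rlim _ _ fC a; rewrite a0 a1 => /(_ isT).
suff -> : lim (f x @[x --> a^'+]) = m * a + c by lra.
apply: cvg_lim => //.
apply: (@cvg_trans _ (m * x + c @[x --> a^'+])); last first.
  exact/cvg_at_right_filter/continuous_affine.
apply: near_eq_cvg; near=> x; apply/esym/mc; apply/andP; split; near: x.
  exact: nbhs_right_gt.
by apply: nbhs_right_ltW; exact: block_lt.
Unshelve. all: end_near. Qed.

(** At 1 this is [0 < f 1]. Elsewhere [f b] is at least the right limit at [b], because [f]
    decreases, and the left end of the next block is already settled. *)
Lemma ptilde_right_gt0 i m c : (i < k)%N -> affine_block f k i m c ->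
  0 < (m + 1) * (i.+1%:R / k%:R) + (c - 1).
Proof.
move=> ik mc; set b := _ / _.
have fb : f b = m * b + c by apply: mc; rewrite lexx block_lt.
suff : 0 < f b + b - 1 by rewrite fb; lra.
have b0 : 0 <= b by exact: block_ge0.
move: ik; rewrite leq_eqVlt => /predU1P[ik|ik].
  have -> : b = 1 by rewrite /b ik divff // pnatr_eq0 -lt0n.
  by have := classP_at1 fC; lra.
have [m' [c' mc']] := ptilde_affine ik.
have := @ptilde_left_gt0 i.+1 _ _ ik mc'; rewrite -/b => g0.
suff : m'%:~R * b + c' <= f b by lra.
rewrite -subr_ge0.
have -> : f b - (m'%:~R * b + c') = - m'%:~R * b + (f b - c') by ring.
apply: (affine_ge_left (block_lt i.+1 k0)) => x /andP[bx xb].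
have fx : f x = m'%:~R * x + c' by apply: mc'; rewrite bx ltW.
suff : f x <= f b by lra.
apply: (classP_decr fC) => //; first exact: ltW.
by rewrite (le_trans (ltW xb)) // block_le1.
Qed.

(** The block starts below [e], so it shares a nontrivial interval with the region where [f = 1],
    and this determines both coefficients. *)
Lemma ptilde_block_near0 (e : R) i m c : (i < k)%N -> affine_block f k i m c ->
  (forall x, 0 <= x <= 1 -> x < e -> f x = 1) -> i%:R / k%:R < e ->
  m = 0 /\ c = 1.
Proof.
move=> ik mc f1 ie; have ab := @block_lt k i k0.
have b1 : i.+1%:R / k%:R <= 1 :> R by rewrite block_le1.
have a0 : 0 <= i%:R / k%:R :> R by exact: block_ge0.
apply: (@affine_inj _ _ _ _ _ (i%:R / k%:R) (Num.min e (i.+1%:R / k%:R))).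
  by rewrite lt_min ie.
move=> x; rewrite lt_min => /and3P[ax xe xb].
by rewrite -mc ?ax ?(ltW xb) // f1 ?mul0r ?add0r // (le_trans a0 (ltW ax)) ltW //
  (lt_le_trans xb).
Qed.

Lemma ptilde_block0 m c : affine_block f k 0 m c -> m = 0 /\ c = 1.
Proof.
move=> mc; have [e [e0 f1]] := classP_near0 fC.
by apply: (@ptilde_block_near0 e 0) => //; rewrite mul0r.
Qed.

(** With [N = q * k], the value is [m * j + q * (k * c)], and [k * c] is an integer because [m] and
    [k * f] at the right end of the block are. *)
Lemma ptilde_int N j : (k %| N)%N -> (0 < N)%N -> (0 < j <= N)%N ->
  N%:R * f (j%:R / N%:R) \is a Num.int.
Proof.
move=> /dvdnP[q Nq] N0 /andP[j0 jN].
have jx : 0 < (j%:R / N%:R : R) <= 1.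
  by rewrite divr_gt0 ?ltr0n // ler_pdivrMr ?ltr0n // mul1r ler_nat.
have [i ik ix] := block_index k0 jx.
have [m [c mc]] := ptilde_affine ik.
have Nj : N%:R * (m%:~R * (j%:R / N%:R)) = m%:~R * j%:R :> R.
  by field; rewrite pnatr_eq0 -lt0n.
rewrite mc // mulrDr Nj rpredD //; first by rewrite rpredM ?intr_int ?natr_int.
have kc : k%:R * c \is a Num.int.
  have -> : k%:R * c = k%:R * f (i.+1%:R / k%:R) - m%:~R * i.+1%:R.
    rewrite mc ?lexx ?block_lt //; field.
    by rewrite pnatr_eq0 -lt0n.
  rewrite rpredB ?(classPtilde_val fP) //.
  by rewrite rpredM ?intr_int ?natr_int.
by rewrite Nq natrM -mulrA rpredM ?natr_int.
Qed.

(** On block 0 the expression is [x]; on any other block it is affine and positive at both ends. *)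
Lemma ptilde_gt0 (x : R) : 0 < x <= 1 -> 0 < f x + x - 1.
Proof.
move=> x01; have [i ik ix] := block_index k0 x01.
have [m [c mc]] := ptilde_affine ik.
have := mc x ix => ->; have := @ptilde_right_gt0 _ _ _ ik mc.
case: i => [|i] in ik ix mc *.
  by have [-> ->] := ptilde_block0 mc; move: x01 => /andP[+ _]; lra.
have := @ptilde_left_gt0 i.+1 _ _ ik mc => g1 g2.
have -> : m%:~R * x + c + x - 1 = (m%:~R + 1) * x + (c - 1) by ring.
move: ix => /andP[/ltW ax xb].
set d := Num.min ((m%:~R + 1) * (i.+1%:R / k%:R) + (c - 1))
  ((m%:~R + 1) * (i.+2%:R / k%:R) + (c - 1)).
have d0 : 0 < d by rewrite lt_min g1.
apply: (lt_le_trans d0).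
apply: (affine_ge_itv (a := i.+1%:R / k%:R) (b := i.+2%:R / k%:R)).
- by rewrite ax xb.
- by rewrite ge_min lexx.
- by rewrite ge_min lexx orbT.
Qed.

End Ptilde.

(** Bounds that may be enlarged are combined by taking their maximum. *)
Lemma exists_finite_bound (Q : nat -> R -> Prop) n :
  (forall i T T', 0 < T -> T <= T' -> Q i T -> Q i T') ->
  (forall i, (i < n)%N -> exists2 T, 0 < T & Q i T) ->
  exists2 T, 0 < T & forall i, (i < n)%N -> Q i T.
Proof.
move=> Qmon; elim: n => [|n IH] h; first by exists 1.
have [|T T0 hT] := IH; first by move=> i /ltnW; exact: h.
have [T' T'0 hT'] := h n (ltnSn n).
exists (Num.max T T') => [|i]; first by rewrite lt_max T0.
rewrite ltnS leq_eqVlt => /predU1P[->|/hT].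
  by apply: Qmon hT' => //; rewrite le_max lexx orbT.
by apply: Qmon => //; rewrite le_max lexx.
Qed.

(* The bound does not depend on [k]: the slopes and the lower bounds are read off
   from one fixed subdivision [k0], and every other subdivision overlaps it. *)
Lemma ptilde_uniform_bound k0 f : (0 < k0)%N -> classPtilde k0 f ->
  exists2 T : R, 0 < T & forall k, (0 < k)%N -> classPtilde k f ->
    forall i m c, (i < k)%N -> affine_block f k i m c ->
    (m = 0 /\ c = 1) \/
    [/\ T^-1 <= i%:R / k%:R, `|m + 1| <= T &
      forall x, i%:R / k%:R <= x <= i.+1%:R / k%:R ->
        T^-1 <= (m + 1) * x + (c - 1)].
Proof.
move=> k00 fP0; have [e [e0 f1]] := classP_near0 (classPtilde_P fP0).
(* The lower bound is proportional to [x] because [f x + x - 1 = x] on block 0; it becomes uniform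
   once [x >= e]. *)
have [i T T' T0 TT' [h1 h2]|i ik|T T0 hT] := @exists_finite_bound (fun i T =>
    (forall m c, affine_block f k0 i m c -> `|m + 1| <= T) /\
    (forall x, i%:R / k0%:R < x <= i.+1%:R / k0%:R ->
       T^-1 * x <= f x + x - 1)) k0.
- split=> [m c /h1 mT|x xi]; first exact: le_trans TT'.
  apply: le_trans (h2 x xi).
  rewrite ler_wpM2r ?lef_pV2 ?posrE ?(lt_le_trans T0) //.
  by move: xi => /andP[/ltW + _]; apply: le_trans; exact: block_ge0.
- have [m [c mc]] := ptilde_affine k00 fP0 ik.
  have uniq m' c' : affine_block f k0 i m' c' -> m' = m%:~R.
    move=> mc'; apply: (fun h => (@affine_inj _ _ c' _ c _ _ (block_lt i k00) h).1).
    by move=> x /andP[ax xb]; rewrite -mc -?mc' // ax ltW.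
  have [i0|i0] := posnP i.
    move: i0 mc uniq => -> mc uniq; have [m0 c1] := ptilde_block0 k00 fP0 mc.
    exists 1 => //; split=> [m' c' /uniq ->|x xi]; first by rewrite m0 add0r normr1.
    by rewrite mc // m0 c1 invr1; lra.
  have gl := @ptilde_left_gt0 _ f k00 fP0 i _ _ (introT andP (conj i0 ik)) mc.
  have gr := @ptilde_right_gt0 _ f k00 fP0 i _ _ ik mc.
  move: gl gr; set l := (X in 0 < X); set r := (X in _ -> 0 < X -> _) => l0 r0.
  have l1 : 0 < l^-1 by rewrite invr_gt0.
  have r1 : 0 < r^-1 by rewrite invr_gt0.
  have n0 : 0 <= `|m%:~R + 1 : R| by [].
  (* The inverse end values put [T^-1] below [l] and [r], hence below the affine function between
     them. *)
  pose T := 1 + `|m%:~R + 1| + l^-1 + r^-1 : R.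
  have T0 : 0 < T by rewrite /T; lra.
  exists T => //.
  split=> [m' c' /uniq ->|x xi]; first by rewrite /T; lra.
  have x1 : x <= 1.
    by move: xi => /andP[_ xb]; rewrite (le_trans xb) // block_le1.
  apply: (@le_trans _ _ T^-1); first by rewrite ler_piMr // invr_ge0 ltW.
  have -> : f x + x - 1 = (m%:~R + 1) * x + (c - 1) by rewrite mc //; ring.
  move: xi => /andP[/ltW ax xb].
  apply: (affine_ge_itv (a := i%:R / k0%:R) (b := i.+1%:R / k0%:R)).
  + by rewrite ax xb.
  + by rewrite -/l -[l]invrK lef_pV2 ?posrE // /T; lra.
  + by rewrite -/r -[r]invrK lef_pV2 ?posrE // /T; lra.
have e1 : 0 < e^-1 by rewrite invr_gt0.
have Te : 0 < T / e by rewrite divr_gt0.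
(* [T] serves the slopes, [e^-1] the left endpoints, and [T / e] the lower bound on [[e, 1]]. *)
pose S := T + e^-1 + T / e.
have S0 : 0 < S by rewrite /S; lra.
exists S => // k k_gt0 fP i m c ik mc.
(* A block of any subdivision either starts where [f = 1] or lies in [[e, 1]]. *)
have [ie|ei] := ltP (i%:R / k%:R) e.
  by left; exact: (ptilde_block_near0 k_gt0 ik mc f1 ie).
right.
have Sg (x : R) : e <= x -> x <= 1 -> S^-1 <= f x + x - 1.
  move=> ex x1; have x01 : 0 < x <= 1 by rewrite x1 (lt_le_trans e0).
  have [j jk xj] := block_index k00 x01.
  apply: le_trans ((hT j jk).2 x xj).
  apply: (@le_trans _ _ (T^-1 * e)); last by rewrite ler_wpM2l // invr_ge0 ltW.
  rewrite -[T^-1 * e]invrK invfM invrK lef_pV2 ?posrE // /S; lra.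
have ab := @block_lt k i k_gt0; have a0 := @block_ge0 k i.
have b1 : i.+1%:R / k%:R <= 1 :> R by rewrite block_le1.
split.
- by apply: le_trans ei; rewrite -[e]invrK lef_pV2 ?posrE // /S; lra.
(* The midpoint lies in some block [j] of the fixed subdivision. Both affine formulas hold between
   the larger of the two left ends and [x], so the slopes agree. *)
- pose x : R := (i%:R / k%:R + i.+1%:R / k%:R) / 2.
  have [ax xb] : i%:R / k%:R < x /\ x < i.+1%:R / k%:R.
    by rewrite /x !midf_lt.
  have x01 : 0 < x <= 1 by rewrite (le_lt_trans a0 ax) (le_trans (ltW xb)).
  have [j jk xj] := block_index k00 x01.
  have [m' [c' mc']] := ptilde_affine k00 fP0 jk.
  suff -> : m = m'%:~R by apply: le_trans ((hT j jk).1 _ _ mc') _; rewrite /S; lra.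
  apply: (fun l h => (@affine_inj _ m c _ c'
    (Num.max (i%:R / k%:R) (j%:R / k0%:R)) x l h).1).
    by rewrite gt_max ax; move: xj => /andP[-> _].
  move=> y; rewrite gt_max => /andP[/andP[iy jy] yx].
  rewrite -mc -?mc' ?iy ?jy //=; last exact: le_trans (ltW yx) (ltW xb).
  by move: xj => /andP[_]; apply: le_trans; exact: ltW.
- have G x : i%:R / k%:R < x < i.+1%:R / k%:R -> S^-1 <= (m + 1) * x + (c - 1).
    move=> /andP[ax xb].
    have -> : (m + 1) * x + (c - 1) = f x + x - 1.
      by rewrite mc ?ax ?(ltW xb) //; ring.
    by apply: Sg; [exact: le_trans (ltW ax)|exact: le_trans (ltW xb) _].
  move=> x xi; apply: (affine_ge_itv xi).
    exact: affine_ge_left ab G.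
  exact: affine_ge_right ab G.
Qed.

End Blocks.

(** * Integration over consecutive half-open intervals *)

Lemma integrableU d (T : measurableType d) (R : realType)
    (mu : {measure set T -> \bar R}) (A B : set T) (f : T -> \bar R) :
  measurable A -> measurable B -> [disjoint A & B] ->
  mu.-integrable A f -> mu.-integrable B f -> mu.-integrable (A `|` B) f.
Proof.
move=> mA mB AB /integrableP[mfA iA] /integrableP[mfB iB].
have mf := (measurable_funU _ mA mB).2 (conj mfA mfB).
apply/integrableP; split => //.
have maf : measurable_fun (A `|` B) (fun x => `|f x|%E) by exact: measurableT_comp.
rewrite (ge0_integral_setU mu mA mB maf) //=.
by rewrite lte_add_pinfty.
Qed.

Section PiecewiseIntegral.
Context {R : realType}.
Local Notation mu := (@lebesgue_measure R).

(** The integrand [g] may differ from the smooth [h] at the left endpoint, where [f] may jump. *)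
Lemma Rintegral_oc_FTC (g h H : R -> R) (a b : R) : a < b ->
  (forall x, a < x <= b -> g x = h x) ->
  (forall x, a <= x <= b -> is_derive x 1 H (h x)) ->
  (forall x, a <= x <= b -> {for x, continuous h}) ->
  mu.-integrable `]a, b] (EFin \o g) /\ \int[mu]_(x in `]a, b]) g x = H b - H a.
Proof.
move=> ab gh dH ch.
have ih : mu.-integrable `]a, b] (EFin \o h).
  apply: integrableS (integrable_segment ch) => //.
  exact: subset_itv_oc_cc.
have E : {in `]a, b]%classic, h =1 g}.
  by move=> x; rewrite inE /= in_itv /= => /gh.
split.
  apply: eq_integrable ih => //.
  by move=> x /E /= ->.
transitivity (\int[mu]_(x in `]a, b]) h x).
  by apply: eq_Rintegral => x /E /= ->.
by rewrite Rintegral_itv_obnd_cbnd //; exact: Rintegral_FTC.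
Qed.

(** The order of the ends and integrability are carried through the induction because additivity of
    the integral over the split interval rests on them. *)
Lemma Rintegral_piecewise (g : R -> R) (p : nat -> R) (h H : nat -> R -> R) n :
  (forall i, (i < n)%N -> p i < p i.+1) ->
  (forall i, (i < n)%N -> forall x, p i < x <= p i.+1 -> g x = h i x) ->
  (forall i, (i < n)%N -> forall x, p i <= x <= p i.+1 ->
     is_derive x 1 (H i) (h i x)) ->
  (forall i, (i < n)%N -> forall x, p i <= x <= p i.+1 ->
     {for x, continuous (h i)}) ->
  [/\ p 0%N <= p n, mu.-integrable `]p 0%N, p n] (EFin \o g) &
    \int[mu]_(x in `]p 0%N, p n]) g x =
    \sum_(0 <= i < n) (H i (p i.+1) - H i (p i))].
Proof.
elim: n => [|n IH] pp gh dH ch.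
  rewrite big_nil lexx; split => //.
    by rewrite set_itvoc0; exact: integrable_set0.
  by rewrite set_itvoc0 Rintegral_set0.
have [||||p0 i0 E0] := IH; try by move=> i /ltnW; auto.
have pn := pp n (ltnSn n).
have [i1 E1] := Rintegral_oc_FTC pn (gh _ (ltnSn n)) (dH _ (ltnSn n))
  (ch _ (ltnSn n)).
have dis : [disjoint `]p 0%N, p n] & `]p n, p n.+1]].
  apply/disj_setPS => x [] /=; rewrite !in_itv /= => /andP[_ xn] /andP[nx _].
  by move: (lt_le_trans nx xn); rewrite ltxx.
have U : `]p 0%N, p n.+1]%classic = `]p 0%N, p n] `|` `]p n, p n.+1].
  by apply: itv_bndbnd_setU; rewrite bnd_simp // ltW.
have iU : mu.-integrable (`]p 0%N, p n] `|` `]p n, p n.+1]) (EFin \o g).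
  exact: integrableU.
rewrite U; split => //; first exact: le_trans (ltW pn).
by rewrite Rintegral_setU // E0 E1 big_nat_recr.
Qed.

(** Writing [ln x = 2 * ln s] with [s = Num.sqrt x], the bound [- ln s = ln s^-1 <= s^-1] gives
    [|x * ln x| <= 2 * s] for [x < 1]. *)
Lemma cvg_xlnx : x * ln x - x @[x --> (0 : R)^'+] --> (0 : R).
Proof.
rewrite -[X in _ --> X](subrr 0); apply: cvgB; last first.
  by apply: cvg_at_right_filter; exact: cvg_id.
have cs : (2 * Num.sqrt x @[x --> (0 : R)^'+]) --> (0 : R).
  rewrite -[X in _ --> X](mulr0 2); apply: cvgM; first exact: cvg_cst.
  rewrite -[X in _ --> X](sqrtr0 R).
  by apply: cvg_at_right_filter; exact: sqrt_continuous.
apply/cvgr0Pnorm_le => e e0; near=> x.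
have x0 : 0 < x by near: x; exact: nbhs_right_gt.
have x1 : x < 1 by near: x; exact: nbhs_right_lt.
have s0 : 0 < Num.sqrt x by rewrite sqrtr_gt0.
have sx : x = Num.sqrt x * Num.sqrt x by rewrite -expr2 sqr_sqrtr // ltW.
apply: (@le_trans _ _ (2 * Num.sqrt x)); last first.
  near: x; move/cvgr0Pnorm_le: cs => /(_ e e0); apply: filterS => x.
  exact: le_trans (ler_norm _).
rewrite normrM gtr0_norm // ler0_norm; last by rewrite ln_le0 // ltW.
have l1 : - ln (Num.sqrt x) <= (Num.sqrt x)^-1.
  by rewrite -lnV ?posrE // ltW // ln_sublinear // invr_gt0.
have -> : ln x = 2 * ln (Num.sqrt x).
  by rewrite {1}sx lnM ?posrE // mulr2n mulrDl !mul1r.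
have -> : x * - (2 * ln (Num.sqrt x)) = 2 * (x * - ln (Num.sqrt x)) by ring.
rewrite ler_wpM2l //; apply: le_trans (ler_wpM2l (ltW x0) l1) _.
by rewrite {1}sx mulfK // lt0r_neq0.
Unshelve. all: end_near. Qed.

End PiecewiseIntegral.

(** * [B_] and [D_] as finite sums over the blocks *)

Section ClosedForms.
Context {R : realType}.
Local Notation mu := (@lebesgue_measure R).
Variables (k : nat) (f : R -> R) (m c : nat -> R).
Hypotheses (k0 : (0 < k)%N) (fP : classPtilde k f).
Hypothesis mc : forall i, (i < k)%N -> affine_block f k i (m i) (c i).

(** The formula of [f x + x - 1] on block [i], extended continuously to the left endpoint. *)
Definition block_arg (i : nat) (x : R) : R := (m i + 1) * x + (c i - 1).

Lemma block_argE i x : (i < k)%N -> i%:R / k%:R < x <= i.+1%:R / k%:R ->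
  f x + x - 1 = block_arg i x.
Proof. by move=> ik xi; rewrite (mc ik xi) /block_arg; ring. Qed.

Lemma block_arg_gt0 i x : (0 < i < k)%N -> i%:R / k%:R <= x <= i.+1%:R / k%:R ->
  0 < block_arg i x.
Proof.
move=> /andP[i0 ik]; rewrite le_eqVlt => /andP[/predU1P[<- _|ax xb]].
  by apply: (ptilde_left_gt0 k0 fP) => //; [rewrite i0|exact: mc].
rewrite -block_argE ?ax //; apply: (ptilde_gt0 k0 fP).
by rewrite (le_lt_trans (block_ge0 _ _) ax) (le_trans xb) // block_le1.
Qed.

(** On block 0 the integrand is [ln x], with primitive [x * ln x - x], whose value at the cut [e]
    tends to 0; the other blocks do not depend on [e]. *)
Lemma B_blocks (H : nat -> R -> R) :
  (forall i, (0 < i < k)%N -> forall x, 0 < block_arg i x ->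
     is_derive x 1 (H i) (ln (block_arg i x))) ->
  B_ f = k%:R^-1 * ln k%:R^-1 - k%:R^-1 +
    \sum_(1 <= i < k) (H i (i.+1%:R / k%:R) - H i (i%:R / k%:R)).
Proof.
move=> dH; set S := \sum_(1 <= i < k) _.
have k1 : 0 < k%:R^-1 :> R by rewrite invr_gt0 ltr0n.
have E (e : R) : 0 < e < k%:R^-1 ->
  \int[mu]_(x in `[e, 1]) ln (f x + x - 1) =
  k%:R^-1 * ln k%:R^-1 - k%:R^-1 + S - (e * ln e - e).
  move=> /andP[e0 ek].
  (* The breakpoints are [e, 1/k, 2/k, ..., 1]: only block 0 is truncated. *)
  pose p i := if i is j.+1 then (j.+1%:R / k%:R : R) else e.
  pose G i := if i is j.+1 then H j.+1 else (fun x => x * ln x - x).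
  pose h i := if i is j.+1 then (fun x => ln (block_arg j.+1 x)) else @ln R.
  have [|i ik x px|i ik x px|i ik x px|_ int Eint] :=
    @Rintegral_piecewise _ (fun x => ln (f x + x - 1)) p h G k.
  - by case=> [|i] ik /=; [rewrite div1r|exact: block_lt].
  - case: i ik px => [|i] ik /= /andP[px xp]; last first.
      by rewrite (block_argE ik) // px.
    have [mE cE] := ptilde_block0 k0 fP (mc k0).
    rewrite (mc k0) ?mE ?cE ?mul0r ?add0r; first by rewrite addrC addKr.
    by rewrite (lt_trans e0).
  - case: i ik px => [|i] ik /= px; last first.
      by apply: dH => //; exact: (block_arg_gt0 (i := i.+1)).
    have x0 : 0 < x by move: px => /andP[+ _]; exact: lt_le_trans.
    have d := is_derive1_ln x0.
    apply: is_derive_eq; rewrite /GRing.scale /=.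
    by field; rewrite lt0r_neq0.
  - case: i ik px => [|i] ik /= px; last first.
      by apply: continuous_ln_affine; exact: (block_arg_gt0 (i := i.+1)).
    by apply: continuous_ln; move: px => /andP[+ _]; exact: lt_le_trans.
  have pk : p k = 1.
    by move: k0; rewrite /p; case: k => // j _; rewrite divff // pnatr_eq0.
  rewrite pk /= in int Eint; rewrite -Rintegral_itv_obnd_cbnd // Eint.
  rewrite big_ltn //= div1r /S.
  rewrite (eq_big_nat _ _ (F2 := fun i => H i (i.+1%:R / k%:R) - H i (i%:R / k%:R))).
    by ring.
  by case.
have C : k%:R^-1 * ln k%:R^-1 - k%:R^-1 + S - (e * ln e - e)
    @[e --> (0 : R)^'+] --> k%:R^-1 * ln k%:R^-1 - k%:R^-1 + S.
  rewrite -[X in _ --> X]subr0; apply: cvgB; first exact: cvg_cst.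
  exact: cvg_xlnx.
apply: cvg_lim => //; apply: cvg_trans C.
apply: near_eq_cvg; near=> e; apply/esym/E; apply/andP; split; near: e.
  exact: nbhs_right_gt.
exact: nbhs_right_lt.
Unshelve. all: end_near. Qed.

Lemma derive1_affine_block i x : (i < k)%N ->
  i%:R / k%:R < x < i.+1%:R / k%:R -> derive1 f x = m i.
Proof.
move=> ik /andP[ax xb]; rewrite derive1E.
have d : is_derive x 1 (fun y => m i * y + c i) (m i).
  by apply: is_derive_eq; rewrite /GRing.scale /=; ring.
rewrite -[RHS](@derive_val _ _ _ _ _ _ _ d); apply: near_eq_derive.
near=> y; apply: (mc ik); apply/andP; split; near: y.
  exact: lt_nbhsr.
by apply: filterS (lt_nbhsl xb) => y /ltW.
Unshelve. all: end_near. Qed.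

(** On each block past the first, the integrand is the derivative of [ln (block_arg i x) - ln x]. On
    block 0 it is zero, as [f = 1] there. *)
Lemma D_blocks : D_ k f = 2^-1 * ln (2 * pi) + 2^-1 *
  \sum_(1 <= i < k) ((ln (block_arg i (i.+1%:R / k%:R)) - ln (i.+1%:R / k%:R)) -
    (ln (block_arg i (i%:R / k%:R)) - ln (i%:R / k%:R))).
Proof.
rewrite /D_; congr (_ + _ * _).
rewrite big_add1 /= big_ltn // [X in X + _](_ : _ = 0) ?add0r; last first.
  have [mE cE] := ptilde_block0 k0 fP (mc k0).
  transitivity (\int[mu]_(x in `]0%:R / k%:R, 1%:R / k%:R[) (0 : R)); last first.
    by rewrite Rintegral_cst // mul0r.
  apply: eq_Rintegral => x; rewrite inE /= in_itv /= => xi.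
  rewrite (derive1_affine_block k0 xi) (mc k0) ?mE ?cE.
    by rewrite mulr0 mul0r !add0r addNr mul0r.
  by move: xi => /andP[-> /ltW].
apply: eq_big_nat => i ik.
have ik' : (i < k)%N by case/andP: ik.
have i0 : 0 < i%:R / k%:R :> R.
  by move: ik => /andP[i0 _]; rewrite divr_gt0 ?ltr0n.
have ab := @block_lt R k i k0.
(* Writing [x] as [1 * x + 0] makes the lemmas on affine arguments apply to [ln x] too. *)
pose h x := (m i + 1) / block_arg i x - 1 / (1 * x + 0).
have pos x : i%:R / k%:R <= x <= i.+1%:R / k%:R -> 0 < 1 * x + 0 :> R.
  by move=> /andP[+ _] => /(lt_le_trans i0); rewrite mul1r addr0.
have ch x : i%:R / k%:R <= x <= i.+1%:R / k%:R -> {for x, continuous h}.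
  move=> xi; apply: (@continuousB _ R^o R).
    exact: is_derive1_continuous (is_derive_inv_affine (block_arg_gt0 ik xi)).
  exact: is_derive1_continuous (is_derive_inv_affine (pos x xi)).
have dF (x : R) : i%:R / k%:R <= x <= i.+1%:R / k%:R ->
    is_derive x 1 (fun y => ln (block_arg i y) - ln (1 * y + 0)) (h x).
  move=> xi; have d1 := is_derive_ln_affine (block_arg_gt0 ik xi).
  have d2 := is_derive_ln_affine (pos x xi).
  exact: is_deriveB.
transitivity (\int[mu]_(x in `]i%:R / k%:R, i.+1%:R / k%:R[) h x).
  apply: eq_Rintegral => x; rewrite inE /= in_itv /= => xi.
  have xi' : i%:R / k%:R <= x <= i.+1%:R / k%:R.
    by move: xi => /andP[/ltW -> /ltW].
  have x0 := pos x xi'; rewrite mul1r addr0 in x0.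
  have xi'' : i%:R / k%:R < x <= i.+1%:R / k%:R.
    by move: xi => /andP[-> /ltW].
  have := block_arg_gt0 ik xi'.
  rewrite (derive1_affine_block ik' xi) (mc ik' xi'') /h /block_arg => g0.
  have -> : m i * x + c i + x - 1 = (m i + 1) * x + (c i - 1) by ring.
  by field; rewrite !lt0r_neq0.
have ic := integrable_segment ch.
rewrite Rintegral_itv_bndo_bndc; last first.
  by apply: integrableS ic => //; exact: subset_itv_oo_cc.
rewrite Rintegral_itv_obnd_cbnd; last first.
  by apply: integrableS ic => //; exact: subset_itv_oc_cc.
by rewrite (Rintegral_FTC ab dF ch) !mul1r !addr0.
Qed.

End ClosedForms.

(** * Summation over the grid of step [1 / N] and the final estimate *)

Section Assembly.
Context {R : realType}.

(** A sum over right endpoints is the trapezoid sum plus half a step times the increment of [F]; the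
    [q] local errors add up. *)
Lemma sum_trapezoid (H F F1 F2 : R -> R) (a s K : R) q : 0 <= s ->
  (forall x, a <= x <= a + q%:R * s -> is_derive x 1 H (F x)) ->
  (forall x, a <= x <= a + q%:R * s -> is_derive x 1 F (F1 x)) ->
  (forall x, a <= x <= a + q%:R * s -> is_derive x 1 F1 (F2 x)) ->
  (forall x, a <= x <= a + q%:R * s -> `|F2 x| <= K) ->
  `|s * \sum_(0 <= r < q) F (a + r.+1%:R * s) - (H (a + q%:R * s) - H a)
    - s / 2 * (F (a + q%:R * s) - F a)| <= q%:R * (K * s ^+ 3).
Proof.
move=> s0; elim: q => [|q IH] dH dF dF1 FK.
  by rewrite big_nil mul0r addr0 !subrr !mulr0 subr0 subr0 normr0 mul0r.
have qs : a + q%:R * s <= a + q.+1%:R * s by rewrite lerD2l ler_wpM2r // ler_nat.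
have aq : a <= a + q%:R * s by rewrite lerDl mulr_ge0.
have sub1 x : a <= x <= a + q%:R * s -> a <= x <= a + q.+1%:R * s.
  by move=> /andP[-> /le_trans->].
have sub2 x : a + q%:R * s <= x <= a + q.+1%:R * s -> a <= x <= a + q.+1%:R * s.
  by move=> /andP[h ->]; rewrite (le_trans aq h).
have := @trapezoid_error _ H F F1 F2 _ _ K qs (fun x hx => dH x (sub2 x hx))
  (fun x hx => dF x (sub2 x hx)) (fun x hx => dF1 x (sub2 x hx))
  (fun x hx => FK x (sub2 x hx)).
have := IH (fun x hx => dH x (sub1 x hx)) (fun x hx => dF x (sub1 x hx))
  (fun x hx => dF1 x (sub1 x hx)) (fun x hx => FK x (sub1 x hx)).
rewrite big_nat_recr //=.
have -> : a + q.+1%:R * s - (a + q%:R * s) = s by rewrite -natr1; ring.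
set u := a + q%:R * s; set v := a + q.+1%:R * s; set S := \sum_(0 <= i < q) _.
set E1 := (X in `|X| <= _ -> _) => e1; set E2 := (X in `|X| <= _ -> _) => e2.
have -> : s * (S + F v) - (H v - H a) - s / 2 * (F v - F a) = E1 - E2.
  by rewrite /E1 /E2; field.
apply: (le_trans (ler_normB _ _)); apply: (le_trans (lerD e1 e2)).
by rewrite -natr1 mulrDl mul1r.
Qed.

Lemma sum_nat_mul (V : zmodType) (G : nat -> V) k q :
  \sum_(0 <= j < k * q) G j = \sum_(0 <= i < k) \sum_(0 <= r < q) G (i * q + r)%N.
Proof.
elim: k => [|k IH]; first by rewrite mul0n !big_nil.
rewrite big_nat_recr //= -IH mulSn addnC.
rewrite (@big_cat_nat _ _ _ (k * q)) ?leq_addr //=; congr (_ + _).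
rewrite -[X in \sum_(X <= _ < _) _]add0n big_addn addKn.
by apply: eq_bigr => r _; rewrite addnC.
Qed.

Lemma ln_prod (G : nat -> R) n : (forall i, (i < n)%N -> 0 < G i) ->
  ln (\prod_(0 <= i < n) G i) = \sum_(0 <= i < n) ln (G i).
Proof.
elim: n => [|n IH] G0; first by rewrite !big_nil ln1.
rewrite !big_nat_recr //= lnM ?posrE ?G0 ?IH // => [i /ltnW/G0 //|].
by rewrite big_nat prodr_gt0 // => i /andP[_ /ltnW/G0].
Qed.

Lemma ln_fact n : ln n`!%:R = \sum_(0 <= i < n) ln i.+1%:R :> R.
Proof.
elim: n => [|n IH]; first by rewrite big_nil fact0 ln1.
by rewrite factS natrM lnM ?posrE ?ltr0n ?fact_gt0 // IH big_nat_recr //= addrC.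
Qed.

(** The ceilings are exact by [ptilde_int], so the factors are [N * g] with [g = f x + x - 1] at the
    grid points [x = j.+1 / N]. Splitting [ln (N * g)] as [ln j.+1 + (ln g - ln x)] brings out
    [N!]. *)
Lemma ln_card_RP k (f : R -> R) N : (0 < k)%N -> classPtilde k f ->
  (0 < N)%N -> (k %| N)%N ->
  ln #|RP (lambda f N)|%:R = ln N`!%:R +
    \sum_(0 <= j < N)
      (ln (f (j.+1%:R / N%:R) + j.+1%:R / N%:R - 1) - ln (j.+1%:R / N%:R)).
Proof.
move=> k0 fP N0 kN; have fC := classPtilde_P fP.
have NR : 0 < N%:R :> R by rewrite ltr0n.
have x01 j : (j < N)%N -> 0 < (j.+1%:R / N%:R : R) <= 1.
  by move=> jN; rewrite divr_gt0 ?ltr0n // ler_pdivrMr // mul1r ler_nat.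
have x01' j : (j < N)%N -> 0 <= (j.+1%:R / N%:R : R) <= 1.
  by move=> /x01/andP[/ltW -> ->].
have lamE (j : 'I_N) : (tnth (lambda f N) j)%:R = N%:R * f (j.+1%:R / N%:R) :> R.
  rewrite tnth_mktuple natr_absz; have [l _] := andP (classP_range fC (x01' _ (ltn_ord j))).
  rewrite ger0_norm ?ceilK ?(ptilde_int k0 fP) ?ltn_ord //.
  by rewrite -(ler_int R) ceilK ?(ptilde_int k0 fP) ?ltn_ord ?mulr_ge0.
rewrite card_RP; last 2 first.
- move=> i j ij; rewrite -(ler_nat R) !lamE ler_wpM2l //.
  have [/ltW i0 _] := andP (x01 _ (ltn_ord i)).
  have [_ j1] := andP (x01 _ (ltn_ord j)).
  apply: (classP_decr fC) => //.
  by rewrite ler_pM2r ?invr_gt0 // ler_nat ltnS.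
- move=> i; rewrite -(ler_nat R) lamE ler_piMr //.
  by have [] := andP (classP_range fC (x01' _ (ltn_ord i))).
have g0 j : (j < N)%N -> 0 < f (j.+1%:R / N%:R) + j.+1%:R / N%:R - 1.
  by move=> /x01; exact: (ptilde_gt0 k0 fP).
(* Positivity of [f x + x - 1] keeps the subtraction in [nat] from truncating. *)
have termE (j : 'I_N) : (tnth (lambda f N) j - (N - j.+1))%N%:R =
    N%:R * (f (j.+1%:R / N%:R) + j.+1%:R / N%:R - 1) :> R.
  have E : N%:R * (f (j.+1%:R / N%:R) + j.+1%:R / N%:R - 1) =
    (tnth (lambda f N) j)%:R - (N%:R - j.+1%:R) :> R.
    by rewrite lamE; field; rewrite lt0r_neq0.
  have Nj : (N - j.+1)%N%:R = N%:R - j.+1%:R :> R by rewrite natrB.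
  rewrite E natrB ?Nj // -(ler_nat R) Nj -subr_ge0 -E mulr_ge0 // ltW //.
  exact: g0.
rewrite natr_prod (eq_bigr _ (fun j _ => termE j)).
rewrite -(big_mkord predT (fun j => N%:R * (f (j.+1%:R / N%:R) + j.+1%:R / N%:R - 1))).
rewrite ln_prod; last by move=> i iN; rewrite mulr_gt0 // g0.
rewrite ln_fact -big_split /=; apply: eq_big_nat => j jN.
rewrite lnM ?posrE ?g0 // ln_div ?posrE ?ltr0n //; ring.
Qed.

(** A primitive of [ln]. *)
Definition xlnx_sub (x : R) : R := x * ln x - x.

Definition log_ratio (m c : nat -> R) i (x : R) : R :=
  ln (block_arg m c i x) - ln x.

(** [sum_trapezoid] on one block of [q] steps, for [log_ratio] with primitive [H - xlnx_sub]. *)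
Lemma block_trapezoid k (f : R -> R) (m c : nat -> R) (H : R -> R) (T : R) N q i :
  N = (k * q)%N -> (0 < q)%N -> (0 < i < k)%N -> classPtilde k f ->
  (forall i, (i < k)%N -> affine_block f k i (m i) (c i)) ->
  (forall x, 0 < block_arg m c i x -> is_derive x 1 H (ln (block_arg m c i x))) ->
  0 < T ->
  (m i = 0 /\ c i = 1) \/
    [/\ T^-1 <= i%:R / k%:R, `|m i + 1| <= T &
      forall x, i%:R / k%:R <= x <= i.+1%:R / k%:R ->
        T^-1 <= (m i + 1) * x + (c i - 1)] ->
  `|N%:R^-1 * \sum_(0 <= r < q) log_ratio m c i ((i * q + r).+1%:R / N%:R)
    - (H (i.+1%:R / k%:R) - H (i%:R / k%:R)
       - (xlnx_sub (i.+1%:R / k%:R) - xlnx_sub (i%:R / k%:R)))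
    - N%:R^-1 / 2 *
      (log_ratio m c i (i.+1%:R / k%:R) - log_ratio m c i (i%:R / k%:R))|
  <= q%:R * ((T ^+ 4 + T ^+ 2) * N%:R^-1 ^+ 3).
Proof.
move=> NE q0 ik fP mc dH T0 hT; pose F := log_ratio m c i.
have k0 : (0 < k)%N by move: ik => /andP[]; lia.
have kR : k%:R != 0 :> R by rewrite pnatr_eq0 -lt0n.
have qR : q%:R != 0 :> R by rewrite pnatr_eq0 -lt0n.
have a0 : 0 < i%:R / k%:R :> R by move: ik => /andP[i0 _]; rewrite divr_gt0 ?ltr0n.
have bE : i%:R / k%:R + q%:R * N%:R^-1 = i.+1%:R / k%:R :> R.
  by rewrite NE natrM -natr1; field; rewrite kR qR.
have pos x : i%:R / k%:R <= x <= i.+1%:R / k%:R -> 0 < x :> R.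
  by move=> /andP[+ _]; exact: lt_le_trans.
have pos1 x : i%:R / k%:R <= x <= i.+1%:R / k%:R -> 0 < 1 * x + 0 :> R.
  by move=> /pos; rewrite mul1r addr0.
have gpos x : i%:R / k%:R <= x <= i.+1%:R / k%:R -> 0 < block_arg m c i x.
  exact: (block_arg_gt0 k0 fP mc ik).
have := @sum_trapezoid (fun x => H x - xlnx_sub x) F
  (fun x => (m i + 1) / block_arg m c i x - 1 / (1 * x + 0))
  (fun x => - ((m i + 1) / block_arg m c i x) ^+ 2 - - (1 / (1 * x + 0)) ^+ 2)
  (i%:R / k%:R) N%:R^-1 (T ^+ 4 + T ^+ 2) q.
rewrite bE.
have -> : (fun x => H x - xlnx_sub x) (i.+1%:R / k%:R) - (fun x => H x - xlnx_sub x) (i%:R / k%:R)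
  = H (i.+1%:R / k%:R) - H (i%:R / k%:R)
       - (xlnx_sub (i.+1%:R / k%:R) - xlnx_sub (i%:R / k%:R)) by ring.
under eq_bigr => r _.
  rewrite (_ : i%:R / k%:R + r.+1%:R * N%:R^-1 = (i * q + r).+1%:R / N%:R); last first.
    by rewrite -addnS natrD natrM NE natrM; field; rewrite kR qR.
  over.
apply.
- by rewrite invr_ge0.
- move=> x xi; have d1 := dH x (gpos x xi); have d2 := is_derive1_ln (pos x xi).
  rewrite /xlnx_sub; apply: is_derive_eq; rewrite /GRing.scale /= /F /log_ratio.
  by field; rewrite lt0r_neq0 // pos.
- move=> x xi; have d1 := is_derive_ln_affine (gpos x xi).
  have d2 := is_derive_ln_affine (pos1 x xi).
  have -> : F = (fun y => ln (block_arg m c i y)) - (fun y => ln (1 * y + 0)).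
    by apply/funext => y; rewrite /F /log_ratio !fctE mul1r addr0.
  exact: is_deriveB.
- move=> x xi; have d1 := is_derive_inv_affine (gpos x xi).
  have d2 := is_derive_inv_affine (pos1 x xi).
  exact: is_deriveB.
(* With [g] for [block_arg], the second derivative is [1 / x^2 - (g' / g)^2]. It vanishes when
   [g x = x]; otherwise [1 / x], [|g'|] and [1 / g] are all at most [T], whence
   [T ^+ 2 + T ^+ 4]. *)
- move=> x xi; rewrite mul1r addr0; have x0 := pos x xi; have g0 := gpos x xi.
  case: hT => [[m0 c1]|[Ta mT Tg]].
    rewrite /block_arg m0 c1 add0r subrr addr0 mul1r opprK addNr normr0.
    by rewrite addr_ge0 // exprn_ge0 // ltW.
  rewrite opprK addrC; apply: (le_trans (ler_normB _ _)); rewrite addrC.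
  have inv y : T^-1 <= y -> y^-1 <= T.
    move=> Ty; rewrite -[T]invrK lef_pV2 ?posrE ?invr_gt0 //.
    by apply: lt_le_trans Ty; rewrite invr_gt0.
  have hx : x^-1 <= T by apply: inv; move: xi => /andP[+ _]; exact: le_trans.
  have hg : (block_arg m c i x)^-1 <= T by apply: inv; exact: Tg.
  rewrite lerD // normrX.
    rewrite (_ : T ^+ 4 = (T * T) ^+ 2); last by ring.
    rewrite ler_pXn2r ?nnegrE ?mulr_ge0 ?(ltW T0) // normrM.
    by rewrite ler_pM // gtr0_norm ?invr_gt0.
  by rewrite mul1r ler_pXn2r ?nnegrE ?(ltW T0) // gtr0_norm ?invr_gt0.
Qed.

End Assembly.

Theorem theorem4p10 (R : realType) (f : R -> R) :
  exists C : R, 0 < C /\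
    forall k : nat, (0 < k)%N -> classPtilde k f ->
    forall N : nat, (0 < N)%N -> (k %| N)%N ->
      `| ln (#|RP (lambda f N)|%:R) - N%:R * ln N%:R - B_ f * N%:R
         - 2^-1 * ln N%:R - D_ k f | <= C / N%:R.
Proof.
(* The constant precedes [k], so it is built from one admissible subdivision; if there is none, any
   positive constant will do. *)
have [[k0 [k0_gt0 fP0]]|none] := pselect (exists k, (0 < k)%N /\ classPtilde k f);
  last by exists 1; split=> // k k_gt0 fP; case: none; exists k.
have [T T0 hT] := ptilde_uniform_bound k0_gt0 fP0.
have K0 : 0 <= T ^+ 4 + T ^+ 2 by rewrite addr_ge0 // exprn_ge0 // ltW.
(* The 1 comes from Stirling's formula, the rest from the trapezoid rule. *)
exists (1 + (T ^+ 4 + T ^+ 2)); split; first by rewrite ltr_pwDl.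
move=> k k_gt0 fP N N0 /[dup] kN /dvdnP[q Nq].
have q0 : (0 < q)%N by move: N0; rewrite Nq; case: q {Nq}.
rewrite mulnC in Nq.
have /choice[mc hmc] : forall i, exists mc : R * R,
    (i < k)%N -> affine_block f k i mc.1 mc.2.
  move=> i; case: (ltnP i k) => ik; last by exists (0, 0).
  by have [m [c h]] := ptilde_affine k_gt0 fP ik; exists (m%:~R, c).
pose m i := (mc i).1; pose c i := (mc i).2.
have {}hmc i : (i < k)%N -> affine_block f k i (m i) (c i) by exact: hmc.
have /choice[H dH] : forall i, exists H : R -> R, forall x,
    0 < block_arg m c i x -> is_derive x 1 H (ln (block_arg m c i x)).
  by move=> i; exact: exists_primitive_ln_affine.
pose L : R -> R := xlnx_sub; pose F := log_ratio m c.
have kR : k%:R != 0 :> R by rewrite pnatr_eq0 -lt0n.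
have qR : q%:R != 0 :> R by rewrite pnatr_eq0 -lt0n.
have NR : 0 < N%:R :> R by rewrite ltr0n.
pose SF : R := \sum_(1 <= i < k) \sum_(0 <= r < q) F i ((i * q + r).+1%:R / N%:R).
pose SH : R := \sum_(1 <= i < k) (H i (i.+1%:R / k%:R) - H i (i%:R / k%:R)).
pose SD : R := \sum_(1 <= i < k) (F i (i.+1%:R / k%:R) - F i (i%:R / k%:R)).
have BE : B_ f = SH + L k%:R^-1.
  by rewrite (B_blocks k_gt0 fP hmc (fun i _ => dH i)) addrC.
have DE : D_ k f = 2^-1 * ln (2 * pi) + 2^-1 * SD.
  exact: (D_blocks k_gt0 fP hmc).
(* The [- 1] is [L 1]; it produces the [+ N] that cancels the [- N] of Stirling's formula. *)
have LE : \sum_(1 <= i < k) (L (i.+1%:R / k%:R) - L (i%:R / k%:R)) = - 1 - L k%:R^-1.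
  rewrite (telescope_sumr (fun i => L (i%:R / k%:R))) // divff // div1r.
  by rewrite {1}/L /xlnx_sub ln1 mulr0 sub0r.
have FE : \sum_(0 <= j < N)
    (ln (f (j.+1%:R / N%:R) + j.+1%:R / N%:R - 1) - ln (j.+1%:R / N%:R)) = SF.
  rewrite [in X in \sum_(0 <= j < X) _]Nq sum_nat_mul big_ltn //=.
  have blk i r : (i < k)%N -> (r < q)%N ->
      ln (f ((i * q + r).+1%:R / N%:R) + (i * q + r).+1%:R / N%:R - 1)
      - ln ((i * q + r).+1%:R / N%:R) = F i ((i * q + r).+1%:R / N%:R).
    move=> ik rq; rewrite (block_argE hmc ik) //.
    have -> : i%:R / k%:R = (i * q)%N%:R / N%:R :> R.
      by rewrite Nq !natrM; field; rewrite kR qR.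
    have -> : i.+1%:R / k%:R = (i.+1 * q)%N%:R / N%:R :> R.
      by rewrite Nq !natrM; field; rewrite kR qR.
    by rewrite ltr_pM2r ?invr_gt0 // ler_pM2r ?invr_gt0 // ltr_nat ler_nat; lia.
  (* Block 0 contributes nothing, as [f x + x - 1 = x] there. *)
  rewrite big_nat_cond big1 ?add0r; last first.
    move=> r /andP[/andP[_ rq] _]; rewrite blk // /F /log_ratio /block_arg.
    have [-> ->] := ptilde_block0 k_gt0 fP (hmc _ k_gt0).
    by rewrite add0r mul1r subrr addr0 subrr.
  by apply: eq_big_nat => i /andP[_ ik]; apply: eq_big_nat => r /andP[_ rq]; exact: blk.
(* At most [k] blocks of [q] steps with errors of order [N ^- 3] add up to order [N ^- 2];
   multiplication by [N] will leave [1 / N]. *)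
have main : `|N%:R^-1 * SF - (SH - (- 1 - L k%:R^-1)) - N%:R^-1 / 2 * SD|
    <= k%:R * (q%:R * ((T ^+ 4 + T ^+ 2) * N%:R^-1 ^+ 3)).
  rewrite -LE /SF /SH /SD !mulr_sumr -!sumrB.
  apply: (le_trans (ler_norm_sum _ _ _)).
  apply: (@le_trans _ _ (\sum_(1 <= i < k)
      q%:R * ((T ^+ 4 + T ^+ 2) * N%:R^-1 ^+ 3))); last first.
    rewrite sumr_const_nat -[leLHS]mulr_natl ler_wpM2r ?ler_nat ?leq_subr //.
    by rewrite !mulr_ge0 // exprn_ge0 // invr_ge0.
  rewrite !big_nat; apply: ler_sum => i ik.
  have := @block_trapezoid _ k f m c (H i) T N q i Nq q0 ik fP hmc (dH i) T0
    (hT k k_gt0 fP i _ _ (proj2 (andP ik)) (hmc i (proj2 (andP ik)))).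
  exact.
have {}main : `|SF - N%:R * (B_ f + 1) - 2^-1 * SD| <= (T ^+ 4 + T ^+ 2) / N%:R.
  rewrite BE.
  have -> : SF - N%:R * (SH + L k%:R^-1 + 1) - 2^-1 * SD =
    N%:R * (N%:R^-1 * SF - (SH - (- 1 - L k%:R^-1)) - N%:R^-1 / 2 * SD).
    by field; rewrite lt0r_neq0.
  rewrite normrM gtr0_norm //; apply: (le_trans (ler_wpM2l (ltW NR) main)).
  rewrite le_eqVlt; apply/orP; left; apply/eqP.
  by rewrite Nq natrM; field; rewrite kR qR.
have st := @stirling R N N0.
rewrite (ln_card_RP k_gt0 fP N0 kN) FE DE.
have -> : ln N`!%:R + SF - N%:R * ln N%:R - B_ f * N%:R - 2^-1 * ln N%:R
    - (2^-1 * ln (2 * pi) + 2^-1 * SD) =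
  (ln N`!%:R - N%:R * ln N%:R + N%:R - 2^-1 * ln N%:R - 2^-1 * ln (2 * pi)) +
  (SF - N%:R * (B_ f + 1) - 2^-1 * SD) by ring.
apply: (le_trans (ler_normD _ _)); apply: (le_trans (lerD st main)).
by rewrite [leRHS]mulrDl div1r.
Qed.
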